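(* Let $r\in\mathbb{N}^{+}$ and let $f:[a,b]\to\mathbb{R}$ be a bounded, (Lebesgue) integrable function. Then $$\lim_{n\to\infty}F_n^r(f;x)=f(x)$$ at every point $x\in[a,b]$ at which $f$ is continuous. Moreover, if $f\in C([a,b])$, then $$\lim_{n\to\infty}\left\|F_n^r(f;\cdot)-f\right\|_\infty=0.$$ (Here $n$ ranges over the positive integers with $\lceil na\rceil\le\lfloor nb\rfloor-r$.)
   Context: Let $[a,b]\subset\mathbb{R}$ with $a<b$, and $\mathbb{N}^+=\{1,2,3,\dots\}$. $C([a,b])$ is the space of continuous functions $f:[a,b]\to\mathbb{R}$, and $\|\cdot\|_\infty$ is the supremum norm on $[a,b]$. A function $\sigma:\mathbb{R}\to\mathbb{R}$ is called sigmoidal if $\lim_{x\to-\infty}\sigma(x)=0$ and $\lim_{x\to+\infty}\sigma(x)=1$. Throughout, $\sigma$ is a fixed non-decreasing sigmoidal function with $\sigma(r+2)>\sigma(r)$ (where $r$ is the order of the operator) such that: $\sigma(x)-1/2$ is an odd function; $\sigma\in C^2(\mathbb{R})$ and $\sigma$ is concave for $x\ge 0$; and $\sigma(x)=O(|x|^{-1-\alpha})$ as $x\to-\infty$ for some $\alpha>0$. The density function generated by $\sigma$ is $$\phi_\sigma(x):=\tfrac12\left[\sigma(x+1)-\sigma(x-1)\right],\quad x\in\mathbb{R}.$$ For $r,n\in\mathbb{N}^{+}$ with $\lceil na\rceil\le\lfloor nb\rfloor-r$, the Steklov neural network operator of order $r$ is $$F_n^r(f;x):=\frac{\sum_{k=\lceil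 na\rceil}^{\lfloor nb\rfloor-r}\left[n^r\int_0^{1/n}\cdots\int_0^{1/n}\sum_{m=1}^r(-1)^{1-m}\binom{r}{m}f\left(\frac{k}{n}+\frac{m}{r}(t_1+\cdots+t_r)\right)dt_1\cdots dt_r\right]\phi_\sigma(nx-k)}{\sum_{k=\lceil na\rceil}^{\lfloor nb\rfloor-r}\phi_\sigma(nx-k)},\quad x\in[a,b].$$ *)

(* Defs.v *)
From HB Require Import structures.
From mathcomp Require Import all_boot all_order all_algebra.
From mathcomp Require Import lra zify.
From mathcomp Require Import all_classical all_reals all_analysis.

Set Implicit Arguments.
Unset Strict Implicit.
Unset Printing Implicit Defensive.

Import Order.TTheory GRing.Theory Num.Theory.
Import numFieldNormedType.Exports.

Local Open Scope classical_set_scope.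
Local Open Scope ring_scope.

(* Lets the Landau notation [g =O_ -oo_R h] typecheck. *)
Canonical ninfty_nbhs_filterType (R : realType) :=
  FilterType (ninfty_nbhs R) _.

Definition sigmoidal (R : realType) (sigma : R -> R) :=
  sigma x @[x --> -oo] --> (0 : R) /\ sigma x @[x --> +oo] --> (1 : R).

Definition class_C2 (R : realType) (g : R -> R) :=
  [/\ forall x, derivable g x 1,
      forall x, derivable (g^`())%classic x 1
    & continuous (g^`(2))%classic].

Definition concave_on (R : realType) (D : set R) (g : R -> R) :=
  convex_function (D : set (convex_lmodType R^o)) (fun x => - g x).

Definition phi (R : realType) (sigma : R -> R) (x : R) : R :=
  2^-1 * (sigma (x + 1) - sigma (x - 1)).

(* The iterated integral of g over [0, h]^r, each variable being integrated
   against the completed Lebesgue measure, so that Lebesgue measurable (and not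
   only Borel measurable) integrands are covered. *)
Fixpoint iterated_integral (R : realType) (h : R) (r : nat) :
    (r.-tuple R -> R) -> R :=
  match r return (r.-tuple R -> R) -> R with
  | 0 => fun g => g [tuple]
  | r'.+1 => fun g =>
      \int[completed_lebesgue_measure]_(t in `[0, h])
        iterated_integral h (fun ts : r'.-tuple R => g [tuple of t :: ts])
  end.

(* Functions on [a, b] are represented by total functions R -> R. For k in
   [steklov_range], only values of f on [a, b] are used. *)
Definition steklov_mean (R : realType) (f : R -> R) (r n : nat) (k : int) : R :=
  n%:R ^+ r * iterated_integral n%:R^-1 (fun t : r.-tuple R =>
    \sum_(1 <= m < r.+1)
      (-1) ^ (1 - m%:Z) * 'C(r, m)%:R *
      f (k%:~R / n%:R + m%:R / r%:R * \sum_(i < r) tnth t i)).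

Definition steklov_range (R : realType) (a b : R) (r n : nat) : set int :=
  [set k | Num.ceil (n%:R * a) <= k <= Num.floor (n%:R * b) - r%:Z].

(* So the sums below, taken over finite supports, never degenerate to 0. *)
Lemma steklov_range_finite (R : realType) (a b : R) (r n : nat) :
  finite_set (steklov_range a b r n).
Proof.
rewrite /steklov_range.
set c := Num.ceil _; set d := Num.floor _ - _.
apply: (@sub_finite_set _ _ ((fun j : nat => c + j%:Z) @` `I_(`|d - c|%N.+1))).
  by move=> k /= /andP[ck kd]; exists `|k - c|%N; lia.
exact/finite_image/finite_II.
Qed.

(* Nothing is lost by letting n tend to infinity over all of nat: the
   values of [steklov_op] at the finitely many n for which [steklov_range] is
   empty (or n = 0) do not affect its limit. *)
Lemma steklov_range_near (R : realType) (a b : R) (r : nat) : a < b ->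
  \forall n \near \oo,
    (0 < n)%N /\ Num.ceil (n%:R * a) <= Num.floor (n%:R * b) - r%:Z.
Proof.
move=> ab.
near=> n; split; first by near: n; exact: nbhs_infty_gt.
have ab0 : 0 < b - a by rewrite subr_gt0.
have nab : (r%:R + 2) / (b - a) <= n%:R by near: n; exact: nbhs_infty_ger.
have floorb := floorD1_gt (n%:R * b).
have {}nab : r%:R + 2 <= n%:R * (b - a) by rewrite -ler_pdivrMr.
rewrite ceil_le_int rmorphB /=; move: floorb; rewrite rmorphD /=; lra.
Unshelve. all: by end_near. Qed.

Definition steklov_op (R : realType) (sigma : R -> R) (a b : R) (r n : nat)
    (f : R -> R) (x : R) : R :=
  (\sum_(k \in steklov_range a b r n)
     steklov_mean f r n k * phi sigma (n%:R * x - k%:~R)) /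
  (\sum_(k \in steklov_range a b r n) phi sigma (n%:R * x - k%:~R)).

(* An extended real, because the supremum [sup] of an unbounded set of reals
   is 0. *)
Definition sup_norm (R : realType) (a b : R) (g : R -> R) : \bar R :=
  ereal_sup [set (`|g x|)%:E | x in `[a, b]].

(* Main.v *)
Require Import Defs.
From mathcomp Require Import all_boot all_order all_algebra.
From mathcomp Require Import ring lra zify.
From mathcomp Require Import all_classical all_reals all_analysis.

(** The value of the operator at x is a weighted average, with nonnegative
    weights phi (n x - k), of the Steklov means of f near the nodes k / n.
    Three facts give the convergence.

    - The r-fold integral is monotone and is exact on constants, and the
      coefficients (-1)^(1-m) 'C(r, m), for m = 1, ..., r, have sum 1 and total
      absolute value at most 2^r. Hence if |f - y| <= e at the points sampled
      by a mean, all of which lie in [k / n, k / n + r / n], then this mean is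
      within 2^r e of y ([steklov_mean_dist]).
    - phi w = G w - G (w - 1) for the nondecreasing bounded function
      G w = (sigma (w + 1) + sigma w) / 2. The weights of the nodes at distance
      at least T / n from x therefore telescope, and their sum is at most
      G (- T) + (1 - G (T - 1)), which tends to 0 as T grows, uniformly in x and
      in the number of nodes ([phi_tail_sum_le], [phi_tail_cvg0]).
    - By oddness and concavity phi is even and is nonincreasing on the
      nonnegative half-line, and some node k of the sum satisfies
      |n x - k| <= r + 1. Hence the total weight is at least
      phi (r + 1) = (sigma (r + 2) - sigma r) / 2 > 0 ([phi_sum_ge]).

    The means at the nodes close to x contribute an error of the order of the
    oscillation of f near x; the others contribute at most a multiple of
    sup |f| times the tail weight. The resulting estimate
    ([steklov_op_dist_near]) depends on f and x only through a bound on |f| and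
    a modulus of continuity of f at x. It yields the convergence at a point of
    continuity, and the uniform convergence once the modulus is made uniform by
    compactness of [a, b]. *)

Set Implicit Arguments.
Unset Strict Implicit.
Unset Printing Implicit Defensive.

Import Order.TTheory GRing.Theory Num.Theory.
Import numFieldNormedType.Exports.

Local Open Scope classical_set_scope.
Local Open Scope ring_scope.

(** * Bounds on iterated integrals *)

(** The integral of a nonnegative function is a supremum over the simple
    functions below it, which is monotone for arbitrary functions; apply this
    to the positive and to the negative parts. Pointwise bounds thus pass to
    the iterated integral, whatever the measurability of the inner integrals. *)
Lemma integral_monotone d (T : measurableType d) (R : realType)
    (mu : {measure set T -> \bar R}) (D : set T) (g1 g2 : T -> \bar R) :
  (forall x, D x -> (g1 x <= g2 x)%E) ->
  (\int[mu]_(x in D) g1 x <= \int[mu]_(x in D) g2 x)%E.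
Proof.
move=> g12.
have le0 (u v : T -> \bar R) : (forall x, D x -> (0 <= u x)%E) ->
    (forall x, D x -> (u x <= v x)%E) ->
    (\int[mu]_(x in D) u x <= \int[mu]_(x in D) v x)%E.
  move=> u0 uv.
  have v0 x (Dx : D x) : (0 <= v x)%E by apply: le_trans (uv _ Dx); exact: u0.
  rewrite !ge0_integralE//; apply: ereal_sup_le => _ [h hu <-].
  exists h => // x; apply: le_trans (hu x) _.
  by rewrite /patch; case: ifPn => //; rewrite inE => /uv.
rewrite integralE [leRHS]integralE; apply: leeB; apply: le0 => // x Dx.
- by rewrite !funeposE ge_max !le_max lexx g12// orbT.
- by rewrite !funenegE ge_max !le_max lexx leeN2 g12// orbT.
Qed.

Lemma completed_lebesgue_measure_segment (R : realType) (h : R) : 0 < h ->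
  completed_lebesgue_measure (`[0, h] : set R) = h%:E.
Proof.
move=> h0.
(* Both measures are restrictions of the same outer measure. *)
have -> : completed_lebesgue_measure (`[0, h] : set R) =
    lebesgue_measure (`[0, h] : set R) by [].
by rewrite lebesgue_measure_itv/= lte_fin h0 sube0.
Qed.

Lemma Rintegral_segment_bounds (R : realType) (h lo hi : R) (g : R -> R) :
  0 < h -> (forall t, 0 <= t <= h -> lo <= g t <= hi) ->
  h * lo <= \int[completed_lebesgue_measure]_(t in `[0, h]) g t <= h * hi.
Proof.
move=> h0 gb.
have mD : measurable (`[0, h] : set (caratheodory_type
    (mu_ext (@wlength R idfun)))).
  by apply: sub_caratheodory; exact: measurable_itv.
pose I : \bar R :=
  (\int[completed_lebesgue_measure]_(t in `[0%R, h]) (g t)%:E)%E.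
have cstE (c : R) :
    (\int[completed_lebesgue_measure]_(t in `[0%R, h]) c%:E)%E = (h * c)%:E.
  rewrite integral_cst// mulrC EFinM.
  by congr (_ * _)%E; exact: completed_lebesgue_measure_segment.
have loI : ((h * lo)%:E <= I)%E.
  rewrite -cstE; apply: integral_monotone => t /=; rewrite in_itv/= => /gb.
  by rewrite lee_fin => /andP[].
have hiI : (I <= (h * hi)%:E)%E.
  rewrite -cstE; apply: integral_monotone => t /=; rewrite in_itv/= => /gb.
  by rewrite lee_fin => /andP[].
have IE : (fine I)%:E = I.
  rewrite fineK// fin_numElt (lt_le_trans _ loI) ?ltNyr//.
  by rewrite (le_lt_trans hiI) ?ltry.
by rewrite -!lee_fin /Rintegral -/I IE loI.
Qed.

Lemma iterated_integral_bounds (R : realType) (h lo hi : R) (r : nat)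
    (g : r.-tuple R -> R) : 0 < h ->
  (forall t : r.-tuple R, (forall i, 0 <= tnth t i <= h) -> lo <= g t <= hi) ->
  h ^+ r * lo <= iterated_integral h g <= h ^+ r * hi.
Proof.
move=> h0; elim: r g => [|r IH] g gb /=.
  by rewrite expr0 !mul1r; apply: gb => -[].
rewrite exprS -!mulrA; apply: Rintegral_segment_bounds => // t t0h.
apply: IH => ts tsb; apply: gb => i.
case: (unliftP ord0 i) => [j ->|->]; last by rewrite tnth0.
by rewrite tnthS.
Qed.

(** * The binomial coefficients of the Steklov means *)

Lemma expN1z_1Bn (R : comUnitRingType) (m : nat) :
  (-1) ^ (1 - m%:Z) = - (-1) ^+ m :> R.
Proof.
by rewrite exprzDr ?unitrN1// expr1z mulN1r -{1}invrN1 exprz_inv opprK.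
Qed.

(** This is the expansion of (1 - 1)^r = 0, with its term of index 0 moved to
    the other side. *)
Lemma alternating_binomial_sum (R : comUnitRingType) (r : nat) : (0 < r)%N ->
  \sum_(1 <= m < r.+1) (-1) ^ (1 - m%:Z) * 'C(r, m)%:R = 1 :> R.
Proof.
move=> r0.
have := exprBn (1 : R) 1 r; rewrite subrr expr0n eqn0Ngt r0/=.
rewrite -(big_mkord xpredT
  (fun i => (-1) ^+ i * 1 ^+ (r - i) * 1 ^+ i *+ 'C(r, i))).
rewrite big_ltn//= bin0 !expr1n !mulr1 mulr1n => /esym/eqP.
rewrite expr0 addrC addr_eq0 -eqr_oppLR -sumrN => /eqP S1.
rewrite -[RHS]S1.
apply: eq_bigr => m _.
by rewrite expN1z_1Bn !expr1n !mulr1 mulr_natr mulNrn.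
Qed.

Lemma binomial_sum_le (R : realDomainType) (r : nat) :
  \sum_(1 <= m < r.+1) 'C(r, m)%:R <= 2 ^+ r :> R.
Proof.
have := exprDn (1 : R) 1 r.
rewrite -[1 + 1]/(2%:R) => ->.
rewrite -(big_mkord xpredT (fun i => 1 ^+ (r - i) * 1 ^+ i *+ 'C(r, i))).
rewrite [leRHS]big_ltn//= ler_wpDl ?bin0 ?expr1n ?mulr1//.
by apply: ler_sum => m _; rewrite !expr1n mulr1.
Qed.

(** * Concave functions on the half-line *)

Lemma concave_on_chord (R : realType) (g : R -> R) (x y t : R) :
  concave_on `[0, +oo[ g -> 0 <= x -> 0 <= y -> 0 <= t <= 1 ->
  t * g x + (1 - t) * g y <= g (t * x + (1 - t) * y).
Proof.
move=> gc x0 y0 /andP[t0 t1].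
have xD : x \in (`[0, +oo[%classic : set R) by rewrite inE/= in_itv/= x0.
have yD : y \in (`[0, +oo[%classic : set R) by rewrite inE/= in_itv/= y0.
have t01 : Itv.spec (@Itv.num_sem R) (Itv.Real `[0%Z, 1%Z]) t.
  by rewrite /= /Itv.num_sem/= realE t0 /= in_itv/= t0.
have : - g (t * x + (1 - t) * y) <= t * - g x + (1 - t) * - g y
  := gc (Itv.mk t01) x y xD yD.
lra.
Qed.

(** Both y and x + h lie between x and y + h, symmetrically about the midpoint:
    y = t (y + h) + (1 - t) x and x + h = (1 - t) (y + h) + t x. Adding
    the two chord inequalities gives the claim. *)
Lemma concave_on_increment (R : realType) (g : R -> R) (x y h : R) :
  concave_on `[0, +oo[ g -> 0 <= x <= y -> 0 <= h ->
  g (y + h) - g y <= g (x + h) - g x.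
Proof.
move=> gc /andP[x0 xy] h0.
have [d0|d0] := eqVneq (y + h - x) 0.
  have -> : h = 0 by lra.
  by rewrite !addr0 !subrr.
have d1 : 0 < y + h - x by rewrite lt_neqAle eq_sym d0/=; lra.
pose t := (y - x) / (y + h - x).
have t01 : 0 <= t <= 1.
  by rewrite /t divr_ge0 ?ler_pdivrMr//; lra.
have yE : t * (y + h) + (1 - t) * x = y by rewrite /t; field.
have xE : (1 - t) * (y + h) + (1 - (1 - t)) * x = x + h by rewrite /t; field.
have yh0 : 0 <= y + h by lra.
have := concave_on_chord gc yh0 x0 t01.
have t01' : 0 <= 1 - t <= 1 by lra.
have := concave_on_chord gc yh0 x0 t01'.
rewrite yE xE; lra.
Qed.

(** * The density function of a sigmoidal function *)

Section density.
Context (R : realType) (sigma : R -> R).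
Hypothesis sigma_nondecreasing : {homo sigma : x y / x <= y}.
Hypothesis sigma_sigmoidal : sigmoidal sigma.

Lemma phi_ge0 w : 0 <= phi sigma w.
Proof.
by rewrite /phi mulr_ge0 ?invr_ge0// subr_ge0 sigma_nondecreasing//; lra.
Qed.

Definition phi_primitive w := 2^-1 * (sigma (w + 1) + sigma w).

Lemma phi_primitiveB w :
  phi_primitive w - phi_primitive (w - 1) = phi sigma w.
Proof. by rewrite /phi_primitive /phi subrK; ring. Qed.

Lemma phi_primitive_mono : {homo phi_primitive : x y / x <= y}.
Proof.
move=> x y xy; rewrite /phi_primitive.
have := sigma_nondecreasing xy.
have : sigma (x + 1) <= sigma (y + 1) by apply: sigma_nondecreasing; lra.
lra.
Qed.

Lemma sigmoidal_bounds w : 0 <= sigma w <= 1.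
Proof.
have [sN sP] := sigma_sigmoidal; apply/andP; split; apply/ler_addgt0Pl => e e0.
- move/cvgrPdist_le : sN => /(_ _ e0)[A [_ hA]].
  have [wA|Aw] := ltP w A.
    by have := hA w wA; rewrite sub0r normrN ler_norml; lra.
  have := hA (A - 1) ltac:(lra); rewrite sub0r normrN ler_norml.
  have : sigma (A - 1) <= sigma w by apply: sigma_nondecreasing; lra.
  lra.
- move/cvgrPdist_le : sP => /(_ _ e0)[A [_ hA]].
  have [wA|Aw] := ltP A w.
    by have := hA w wA; rewrite ler_norml; lra.
  have := hA (A + 1) ltac:(lra); rewrite ler_norml.
  have : sigma w <= sigma (A + 1) by apply: sigma_nondecreasing; lra.
  lra.
Qed.

(** The variation of [phi_primitive] on ]-oo, - T] and on [T - 1, +oo[, since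
    its limits at -oo and +oo are 0 and 1. *)
Definition phi_tail T := phi_primitive (- T) + (1 - phi_primitive (T - 1)).

(** The sum telescopes once phi is replaced by the increments of Q, a
    nondecreasing function with the same increments as [phi_primitive] on
    ]-oo, - T] and on [T - 1, +oo[, and constant in between if T >= 1/2. The
    truncation is at T - 1, not T, because the increment ending at w >= T
    starts at w - 1. *)
Lemma phi_tail_sum_le (T v : R) (N : nat) :
  \sum_(j < N | T <= `|v - j%:R|) phi sigma (v - j%:R) <= phi_tail T.
Proof.
pose Q w := phi_primitive (Num.min w (- T)) + phi_primitive (Num.max w (T - 1)).
have Qmono : {homo Q : x y / x <= y}.
  move=> x y xy; apply: lerD; apply: phi_primitive_mono.
    by rewrite le_min !ge_min xy lexx orbT.
  by rewrite ge_max !le_max xy lexx orbT.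
have phiQ w : T <= `|w| -> phi sigma w <= Q w - Q (w - 1).
  move=> Tw; rewrite -phi_primitiveB /Q.
  have [w0|w0] := leP 0 w.
    rewrite ger0_norm// in Tw.
    have -> : Num.max w (T - 1) = w by apply/max_idPl; lra.
    have -> : Num.max (w - 1) (T - 1) = w - 1 by apply/max_idPl; lra.
    have : phi_primitive (Num.min (w - 1) (- T)) <=
        phi_primitive (Num.min w (- T)).
      apply: phi_primitive_mono.
      by rewrite le_min !ge_min lexx orbT andbT gerBl ler01.
    lra.
  rewrite ltr0_norm// in Tw.
  have -> : Num.min w (- T) = w by apply/min_idPl; lra.
  have -> : Num.min (w - 1) (- T) = w - 1 by apply/min_idPl; lra.
  have : phi_primitive (Num.max (w - 1) (T - 1)) <=
      phi_primitive (Num.max w (T - 1)).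
    apply: phi_primitive_mono.
    by rewrite ge_max !le_max lexx orbT andbT gerBl ler01.
  lra.
suff: \sum_(j < N | T <= `|v - j%:R|) phi sigma (v - j%:R) <=
    Q v - Q (v - N%:R).
  move=> /le_trans; apply.
  have b w : 0 <= phi_primitive w <= 1.
    have := sigmoidal_bounds w; have := sigmoidal_bounds (w + 1).
    rewrite /phi_primitive; lra.
  rewrite /Q /phi_tail.
  have := b (Num.min (v - N%:R) (- T)); have := b (Num.max v (T - 1)).
  have : phi_primitive (Num.min v (- T)) <= phi_primitive (- T).
    by apply: phi_primitive_mono; rewrite ge_min lexx orbT.
  have : phi_primitive (T - 1) <= phi_primitive (Num.max (v - N%:R) (T - 1)).
    by apply: phi_primitive_mono; rewrite le_max lexx orbT.
  lra.
apply: (@le_trans _ _ (\sum_(j < N) (Q (v - j%:R) - Q (v - j.+1%:R)))).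
  rewrite big_mkcond/=; apply: ler_sum => j _.
  have -> : v - j.+1%:R = v - j%:R - 1 by rewrite -natr1; ring.
  case: ifP => [/phiQ//|_]; rewrite subr_ge0; apply: Qmono; lra.
rewrite -(big_mkord xpredT (fun j => Q (v - j%:R) - Q (v - j.+1%:R))).
rewrite (telescope_sumr_eq (fun j => - Q (v - j%:R)))// ?subr0; first lra.
by move=> *; lra.
Qed.

Lemma phi_tail_cvg0 : phi_tail T @[T --> +oo] --> 0.
Proof.
have [sN sP] := sigma_sigmoidal; apply/cvgrPdist_le => e e0.
have e20 : 0 < e / 2 by lra.
move/cvgrPdist_le : sN => /(_ _ e20)[A [_ hA]].
move/cvgrPdist_le : sP => /(_ _ e20)[B [_ hB]].
near=> T.
have TA : 1 - A < T by near: T; apply: nbhs_pinfty_gt; exact: num_real.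
have TB : 1 + B < T by near: T; apply: nbhs_pinfty_gt; exact: num_real.
have A1 : - T < A by lra.
have A2 : - T + 1 < A by lra.
have B1 : B < T by lra.
have B2 : B < T - 1 by lra.
have := hA _ A1; have := hA _ A2; have := hB _ B1; have := hB _ B2.
by rewrite /phi_tail /phi_primitive subrK !ler_norml; lra.
Unshelve. all: by end_near. Qed.

(** In the application, u j is the error of the j-th mean: B bounds it at the
    nodes near the evaluation point, and the crude bound A is only paid for on
    the tail. *)
Lemma weighted_phi_sum_le (T v A B : R) (N : nat) (u : nat -> R) :
  0 <= A -> 0 <= B -> (forall j, (j < N)%N -> `|u j| <= A) ->
  (forall j, (j < N)%N -> `|v - j%:R| < T -> `|u j| <= B) ->
  `|\sum_(j < N) u j * phi sigma (v - j%:R)| <=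
  B * (\sum_(j < N) phi sigma (v - j%:R)) + A * phi_tail T.
Proof.
move=> A0 B0 uA uB; apply: (le_trans (ler_norm_sum _ _ _)).
apply: (@le_trans _ _ (\sum_(j < N) (B * phi sigma (v - j%:R)) +
    \sum_(j < N | T <= `|v - j%:R|) (A * phi sigma (v - j%:R)))); last first.
  apply: lerD; first by rewrite mulr_sumr.
  by apply: le_trans (ler_wpM2l A0 (phi_tail_sum_le T v N)); rewrite mulr_sumr.
rewrite [X in _ + X]big_mkcond/= -big_split/=; apply: ler_sum => j _.
rewrite normrM (ger0_norm (phi_ge0 _)).
have p0 := phi_ge0 (v - j%:R).
case: ifPn => [_|].
  by rewrite -mulrDl ler_wpM2r// (le_trans (uA _ _))// lerDr.
by rewrite -ltNge => jT; rewrite addr0 ler_wpM2r// uB.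
Qed.

End density.

Section symmetric_density.
Context (R : realType) (sigma : R -> R).
Hypothesis sigma_odd : forall x, sigma (- x) - 2^-1 = - (sigma x - 2^-1).
Hypothesis sigma_concave : concave_on `[0, +oo[ sigma.

Lemma phi_even x : phi sigma (- x) = phi sigma x.
Proof.
rewrite /phi.
have -> : - x + 1 = - (x - 1) by ring.
have -> : - x - 1 = - (x + 1) by ring.
have := sigma_odd (x - 1); have := sigma_odd (x + 1); lra.
Qed.

(** For x >= 1 this compares increments of sigma over two intervals of length 2
    of the half-line where sigma is concave. On [0, 1] one of the end points,
    x - 1, is negative; oddness gives
    2 phi x = sigma (1 + x) + sigma (1 - x) - 1,
    and a concave function has a smaller sum at points spread further apart
    about 1. *)
Lemma phi_antitone x y : 0 <= x <= y -> phi sigma y <= phi sigma x.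
Proof.
have far u w : 1 <= u <= w -> phi sigma w <= phi sigma u.
  move=> uw; rewrite /phi.
  have uw1 : 0 <= u - 1 <= w - 1 by lra.
  have := concave_on_increment sigma_concave uw1 (ler0n R 2).
  have -> : u - 1 + 2%:R = u + 1 by lra.
  have -> : w - 1 + 2%:R = w + 1 by lra.
  lra.
have close u w : 0 <= u <= w -> w <= 1 -> phi sigma w <= phi sigma u.
  move=> uw w1; rewrite /phi.
  have uw1 : 0 <= 1 - w <= 1 + u by lra.
  have uw0 : 0 <= w - u by lra.
  have := concave_on_increment sigma_concave uw1 uw0.
  have -> : 1 + u + (w - u) = w + 1 by ring.
  have -> : 1 - w + (w - u) = 1 - u by ring.
  have := sigma_odd (1 - u); have := sigma_odd (1 - w).
  rewrite !opprB [1 + u]addrC; lra.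
move=> xy; have [y1|y1] := leP y 1; first exact: close.
have [x1|x1] := leP 1 x; first by apply: far; lra.
apply: (@le_trans _ _ (phi sigma 1)); first by apply: far; lra.
by apply: close; lra.
Qed.

Lemma phi_ge_on w z : `|w| <= z -> phi sigma z <= phi sigma w.
Proof.
move=> wz.
have -> : phi sigma w = phi sigma `|w|.
  have [w0|w0] := leP 0 w; first by rewrite ger0_norm.
  by rewrite ltr0_norm ?phi_even.
by apply: phi_antitone => //; rewrite normr_ge0.
Qed.

End symmetric_density.

(** * Steklov means and their nodes *)

(** Since the coefficients sum to 1, the integrand minus y is the combination,
    with the same coefficients, of the differences f - y at the sampled points;
    it is bounded pointwise by 2^r e, and so is its average over the cube. *)
Lemma steklov_mean_dist (R : realType) (f : R -> R) (r n : nat) (k : int)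
    (y e : R) : (0 < r)%N -> (0 < n)%N ->
  (forall s, 0 <= s <= r%:R / n%:R -> `|f (k%:~R / n%:R + s) - y| <= e) ->
  `|steklov_mean f r n k - y| <= 2 ^+ r * e.
Proof.
move=> r0 n0 fe.
have nR : 0 < n%:R :> R by rewrite ltr0n.
have rR : 0 < r%:R :> R by rewrite ltr0n.
have e0 : 0 <= e.
  by apply: le_trans (normr_ge0 _) (fe 0 _); rewrite lexx divr_ge0.
pose c (m : nat) : R := (-1) ^ (1 - m%:Z) * 'C(r, m)%:R.
have cE m : `|c m| = 'C(r, m)%:R.
  by rewrite normrM expN1z_1Bn normrN normrX normrN1 expr1n mul1r normr_nat.
pose g (t : r.-tuple R) := \sum_(1 <= m < r.+1)
      c m * f (k%:~R / n%:R + m%:R / r%:R * \sum_(i < r) tnth t i).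
have gy (t : r.-tuple R) : (forall i, 0 <= tnth t i <= n%:R^-1) ->
    y - 2 ^+ r * e <= g t <= y + 2 ^+ r * e.
  move=> t0n; rewrite -ler_distl.
  have t0 : 0 <= \sum_(i < r) tnth t i.
    by apply: sumr_ge0 => i _; case/andP: (t0n i).
  have tn : \sum_(i < r) tnth t i <= r%:R / n%:R.
    have -> : r%:R / n%:R = \sum_(i < r) (n%:R^-1 : R).
      by rewrite sumr_const card_ord mulr_natl.
    by apply: ler_sum => i _; case/andP: (t0n i).
  have -> : g t - y = \sum_(1 <= m < r.+1)
      c m * (f (k%:~R / n%:R + m%:R / r%:R * \sum_(i < r) tnth t i) - y).
    rewrite -[X in _ - X]mul1r -[X in _ - X * _](alternating_binomial_sum R r0).
    rewrite mulr_suml -sumrB.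
    by apply: eq_bigr => m _; rewrite mulrBr.
  apply: (le_trans (ler_norm_sum _ _ _)).
  apply: (@le_trans _ _ (\sum_(1 <= m < r.+1) 'C(r, m)%:R * e)); last first.
    by rewrite -mulr_suml ler_wpM2r// binomial_sum_le.
  rewrite [leLHS]big_nat_cond [leRHS]big_nat_cond.
  apply: ler_sum => m /andP[/andP[m1 mr] _].
  rewrite normrM cE ler_wpM2l// fe// mulr_ge0 ?divr_ge0//=.
  apply: le_trans tn; rewrite -[leRHS]mul1r ler_wpM2r// ler_pdivrMr// mul1r.
  by rewrite ler_nat.
have nV : 0 < n%:R^-1 :> R by rewrite invr_gt0.
have := iterated_integral_bounds nV gy.
rewrite ler_distl /steklov_mean -/g => /andP[lo hi].
have nr : 0 <= n%:R ^+ r :> R by rewrite exprn_ge0.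
have nK (z : R) : z = n%:R ^+ r * (n%:R^-1 ^+ r * z).
  by rewrite exprVn mulVKf// expf_neq0// gt_eqF.
by rewrite (nK (y - 2 ^+ r * e)) (nK (y + 2 ^+ r * e)) !ler_wpM2l.
Qed.

Lemma steklov_range_sum (R : realType) (a b : R) (r n : nat) (F : int -> R)
    (c d : int) :
  c = Num.ceil (n%:R * a) -> d = Num.floor (n%:R * b) - r%:Z -> c <= d ->
  \sum_(k \in steklov_range a b r n) F k =
  \sum_(j < `|d - c|%N.+1) F (c + j%:Z).
Proof.
rewrite /steklov_range => <- <- cd.
rewrite (fsbig_ord _ _ (fun j => F (c + j%:Z))).
apply: reindex_fsbig; split.
- by move=> j /=; lia.
- by move=> i j _ _ /=; lia.
- by move=> k /= ckd; exists `|k - c|%N; lia.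
Qed.

Lemma steklov_node_itv (R : realType) (a b : R) (r n : nat) (k : int) (s : R) :
  (0 < n)%N -> steklov_range a b r n k -> 0 <= s <= r%:R / n%:R ->
  a <= k%:~R / n%:R + s <= b.
Proof.
move=> n0 /andP[]; have nR : 0 < n%:R :> R by rewrite ltr0n.
rewrite ceil_le_int lerBrDr floor_ge_int rmorphD/= => ak kb /andP[s0 sr].
apply/andP; split.
  by apply: ler_wpDr => //; rewrite ler_pdivlMr// mulrC.
apply: (@le_trans _ _ (k%:~R / n%:R + r%:R / n%:R)); first by rewrite lerD2l.
by rewrite -mulrDl ler_pdivrMr// mulrC.
Qed.

(** The distance is largest when n x is close to n b: the last node is
    floor (n b) - r, hence the constant r + 1. *)
Lemma steklov_node_near (R : realType) (a b x : R) (r n : nat) :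
  Num.ceil (n%:R * a) <= Num.floor (n%:R * b) - r%:Z -> a <= x <= b ->
  exists2 k, steklov_range a b r n k & `|n%:R * x - k%:~R| <= r%:R + 1.
Proof.
rewrite /steklov_range; move=> cd /andP[ax xb].
have nax : n%:R * a <= n%:R * x by rewrite ler_wpM2l.
have nxb : n%:R * x <= n%:R * b by rewrite ler_wpM2l.
have r0 : 0 <= r%:R :> R by [].
have [xc|cx] := ltP (n%:R * x) (Num.ceil (n%:R * a))%:~R.
  exists (Num.ceil (n%:R * a)); first by rewrite /= lexx.
  have := ceilB1_lt (n%:R * a).
  by rewrite rmorphB/= ler_norml; lra.
have [fd|df] := leP (Num.floor (n%:R * x)) (Num.floor (n%:R * b) - r%:Z).
  exists (Num.floor (n%:R * x)); first by rewrite /= fd floor_ge_int cx.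
  have := floor_itv (n%:R * x).
  by rewrite rmorphD/= ler_norml; lra.
exists (Num.floor (n%:R * b) - r%:Z); first by rewrite /= cd lexx.
have := floorD1_gt (n%:R * b).
move/ltW: df; rewrite floor_ge_int.
by rewrite !rmorphD rmorphN/= ler_norml; lra.
Qed.

(** * Approximation by the Steklov operator *)

Section approximation.
Context (R : realType) (sigma : R -> R).
Hypothesis sigma_nondecreasing : {homo sigma : x y / x <= y}.
Hypothesis sigma_sigmoidal : sigmoidal sigma.
Hypothesis sigma_odd : forall x, sigma (- x) - 2^-1 = - (sigma x - 2^-1).
Hypothesis sigma_concave : concave_on `[0, +oo[ sigma.
Variables (a b : R) (r : nat).
Hypothesis phi_gt0 : 0 < phi sigma (r%:R + 1).

Lemma phi_sum_ge x n :
  Num.ceil (n%:R * a) <= Num.floor (n%:R * b) - r%:Z -> a <= x <= b ->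
  phi sigma (r%:R + 1) <=
  \sum_(k \in steklov_range a b r n) phi sigma (n%:R * x - k%:~R).
Proof.
move=> cd axb.
have [k kr kx] := steklov_node_near cd axb.
rewrite (fsbigD1 k)//=; last first.
  by apply: sub_finite_set (steklov_range_finite a b r n) => ? [].
apply: le_trans (phi_ge_on sigma_odd sigma_concave kx) _.
rewrite lerDl; apply: fsumr_ge0 => i _; exact: phi_ge0.
Qed.

(** A node with |n x - k| < T, for T = n delta - r, has all of its sampled
    points, which lie in [k / n, k / n + r / n], within delta of x. *)
Lemma steklov_op_dist n (f : R -> R) (x M e delta : R) :
  (0 < r)%N -> (0 < n)%N ->
  Num.ceil (n%:R * a) <= Num.floor (n%:R * b) - r%:Z ->
  a <= x <= b ->
  (forall y, a <= y <= b -> `|f y - f x| <= M) ->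
  (forall y, a <= y <= b -> `|y - x| <= delta -> `|f y - f x| <= e) ->
  0 <= e ->
  `|steklov_op sigma a b r n f x - f x| <=
  2 ^+ r *
    (e + M * (phi_tail sigma (n%:R * delta - r%:R) / phi sigma (r%:R + 1))).
Proof.
move=> r0 n0 cd axb fM fe e0.
have nR : 0 < n%:R :> R by rewrite ltr0n.
set T := n%:R * delta - r%:R.
have M0 : 0 <= M by apply: le_trans (normr_ge0 _) (fM x axb).
have [c cE] : {c | c = Num.ceil (n%:R * a)} by exists (Num.ceil (n%:R * a)).
have [d dE] : {d | d = Num.floor (n%:R * b) - r%:Z}
  by exists (Num.floor (n%:R * b) - r%:Z).
have := phi_sum_ge cd axb.
rewrite -cE -dE in cd.
rewrite /steklov_op.
pose N := `|d - c|%N.+1.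
pose v := n%:R * x - c%:~R.
have vE (j : nat) : n%:R * x - (c + j%:Z)%:~R = v - j%:R.
  by rewrite rmorphD/= /v; ring.
have sumE (G : int -> R) :
    \sum_(k \in steklov_range a b r n) G k * phi sigma (n%:R * x - k%:~R) =
    \sum_(j < N) G (c + j%:Z) * phi sigma (v - j%:R).
  by rewrite (steklov_range_sum _ cE dE cd); apply: eq_bigr => j _; rewrite vE.
have -> : \sum_(k \in steklov_range a b r n) phi sigma (n%:R * x - k%:~R) =
    \sum_(j < N) phi sigma (v - j%:R).
  by rewrite (steklov_range_sum _ cE dE cd); apply: eq_bigr => j _; rewrite vE.
rewrite sumE; set S := (\sum_(j < N) phi sigma (v - j%:R)) => pS.
have S0 : 0 < S by apply: lt_le_trans phi_gt0 pS.
pose u j := steklov_mean f r n (c + j%:Z) - f x.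
have -> : (\sum_(j < N)
      steklov_mean f r n (c + j%:Z) * phi sigma (v - j%:R)) / S - f x =
    (\sum_(j < N) u j * phi sigma (v - j%:R)) / S.
  rewrite -{1}(mulfK (lt0r_neq0 S0) (f x)) -mulrBl; congr (_ / S).
  by rewrite /S mulr_sumr -sumrB; apply: eq_bigr => j _; rewrite mulrBl.
rewrite normrM normfV (gtr0_norm S0) ler_pdivrMr//.
have kr j : (j < N)%N -> steklov_range a b r n (c + j%:Z).
  by rewrite /N /steklov_range/= -cE -dE; lia.
have uM j : (j < N)%N -> `|u j| <= 2 ^+ r * M.
  move=> /kr jr; apply: steklov_mean_dist => // s sb.
  by apply/fM/(@steklov_node_itv _ a b r).
have ue j : (j < N)%N -> `|v - j%:R| < T -> `|u j| <= 2 ^+ r * e.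
  move=> /kr jr jT; apply: steklov_mean_dist => // s sb.
  apply: fe; first exact: (@steklov_node_itv _ a b r).
  have -> : (c + j%:Z)%:~R / n%:R + s - x = s - (v - j%:R) / n%:R.
    by rewrite -vE mulrBl [n%:R * x]mulrC mulfK ?gt_eqF//; ring.
  apply: le_trans (ler_normB _ _) _; case/andP: sb => s0 sr.
  rewrite ger0_norm// normrM normfV (gtr0_norm nR).
  have : `|v - j%:R| / n%:R <= delta - r%:R / n%:R.
    by rewrite ler_pdivrMr// mulrBl divfK ?gt_eqF// mulrC ltW.
  lra.
have tail0 : 0 <= phi_tail sigma T.
  apply: le_trans
    (phi_tail_sum_le sigma_nondecreasing sigma_sigmoidal T v 0).
  by rewrite big_ord0.
have r2 : 0 <= 2 ^+ r :> R by rewrite exprn_ge0.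
apply: le_trans (weighted_phi_sum_le sigma_nondecreasing sigma_sigmoidal
  (mulr_ge0 r2 M0) (mulr_ge0 r2 e0) uM ue) _.
rewrite -/S -!mulrA -mulrDr ler_wpM2l// mulrDl lerD2l -!mulrA ler_wpM2l//.
(* It remains that the total weight S is at least phi (r + 1). *)
by rewrite ler_peMr// ler_pdivlMl// mulr1.
Qed.

(** The rank from which the estimate holds is chosen before f and x; this
    uniformity is what the convergence in sup norm rests on. *)
Lemma steklov_op_dist_near (M e delta : R) :
  (0 < r)%N -> a < b -> 0 <= M -> 0 < e -> 0 < delta ->
  \forall n \near \oo, forall (f : R -> R) (x : R), a <= x <= b ->
    (forall y, a <= y <= b -> `|f y| <= M) ->
    (forall y, a <= y <= b -> `|y - x| <= delta -> `|f y - f x| <= e) ->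
    `|steklov_op sigma a b r n f x - f x| <= 2 ^+ r * (e + e).
Proof.
move=> r0 ab M0 e0 d0.
(* A tail of at most e1 gives 2 M tail / phi (r + 1) <= e; adding 1 to 2 M
   allows M = 0. *)
pose e1 := e * phi sigma (r%:R + 1) / (2 * M + 1).
have e10 : 0 < e1.
  apply: divr_gt0; first exact: mulr_gt0.
  lra.
have /cvgrPdist_le/(_ _ e10)[A [_ hA]] :=
  phi_tail_cvg0 sigma_sigmoidal.
near=> n.
have [n0 cd] : (0 < n)%N /\ Num.ceil (n%:R * a) <= Num.floor (n%:R * b) - r%:Z.
  by near: n; exact: steklov_range_near.
(* This makes n delta - r larger than A. *)
have An : (A + r%:R + 1) / delta <= n%:R by near: n; exact: nbhs_infty_ger.
move=> f x axb fM fe.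
have f2M y : a <= y <= b -> `|f y - f x| <= 2 * M.
  move=> ayb; apply: le_trans (ler_normB _ _) _.
  by have := fM y ayb; have := fM x axb; lra.
apply: le_trans (steklov_op_dist r0 n0 cd axb f2M fe (ltW e0)) _.
rewrite ler_wpM2l ?exprn_ge0// lerD2l.
have := hA (n%:R * delta - r%:R) _.
rewrite sub0r normrN => /(_ _)/(le_trans (ler_norm _)) tail.
have {}tail : phi_tail sigma (n%:R * delta - r%:R) <= e1.
  by apply: tail; move: An; rewrite ler_pdivrMr//; lra.
rewrite mulrA ler_pdivrMr//.
apply: (@le_trans _ _ (2 * M * e1)); first by rewrite ler_wpM2l// mulr_ge0.
rewrite /e1 mulrA ler_pdivrMr; last lra.
rewrite mulrC ler_wpM2l//; last lra.
by rewrite mulr_ge0// ltW.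
Unshelve. all: by end_near. Qed.

End approximation.

(** * Uniform continuity on a segment *)

(** Continuity at x bounds |f y - f x| by e / 2 around x, so that for x' near x
    and d near 0 the values of f at distance at most d from x' are within e of
    f x'; a covering argument then makes d independent of x. *)
Lemma segment_unif_continuous (R : realType) (a b e : R) (f : R -> R) :
  {within `[a, b], continuous f} -> 0 < e ->
  exists2 delta, 0 < delta & forall x y, a <= x <= b -> a <= y <= b ->
    `|y - x| <= delta -> `|f y - f x| <= e.
Proof.
move=> /subspace_continuousP fc e0.
have /compact_near_coveringP/near_covering_withinP cov :=
  @segment_compact R a b.
have /= := @cov R (0^'+) (fun d x => forall y, a <= y <= b -> `|y - x| <= d ->
  `|f y - f x| <= e) _ _.
have loc x : `[a, b]%classic x -> \forall x' \near x & d \near 0^'+,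
    `[a, b]%classic x' -> forall y, a <= y <= b -> `|y - x'| <= d ->
      `|f y - f x'| <= e.
  move=> xab; have e20 : 0 < e / 2 by lra.
  have /cvgrPdist_le/(_ _ e20) := fc x xab.
  rewrite /prop_near1 /within/= => /nbhs_ballP[d d0 hd].
  have d20 : 0 < d / 2 by rewrite /= in d0 *; lra.
  near=> x' d' => /=; rewrite in_itv/= => ax'b y ayb yx'.
  have x'x : `|x - x'| < d / 2 by near: x'; exact: nbhsx_ballx.
  have d'd : d' < d / 2 by near: d'; exact: nbhs_right_lt.
  have xd : `|f x - f x'| <= e / 2.
    by apply: hd; rewrite /= ?in_itv// /ball/=; lra.
  have yd : `|f x - f y| <= e / 2.
    apply: hd; rewrite /= ?in_itv// /ball/=.
    have -> : x - y = (x - x') - (y - x') by ring.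
    apply: le_lt_trans (ler_normB _ _) _; lra.
  have -> : f y - f x' = (f x - f x') - (f x - f y) by ring.
  apply: le_trans (ler_normB _ _) _; lra.
move=> /(_ _ loc) => near_d.
have [d [d0 hd]] := @filter_ex _ (0^'+) _ _ (filterI (nbhs_right_gt 0) near_d).
by exists d => // x y axb; apply: hd; rewrite /= in_itv.
Unshelve. all: by end_near. Qed.

Theorem theorem2 (R : realType) (a b : R) (hab : a < b)
    (r : nat) (hr : (0 < r)%N)
    (sigma : R -> R)
    (sigma_nondecreasing : {homo sigma : x y / x <= y})
    (sigma_sigmoidal : sigmoidal sigma)
    (sigma_r : sigma r%:R < sigma (r%:R + 2))
    (sigma_odd : forall x, sigma (- x) - 2^-1 = - (sigma x - 2^-1))
    (sigma_C2 : class_C2 sigma)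
    (sigma_concave : concave_on `[0, +oo[ sigma)
    (alpha : R) (halpha : 0 < alpha)
    (sigma_decay : sigma =O_ (-oo_R) (fun x : R => `|x| `^ (- 1 - alpha)))
    (f : R -> R) :
  ([bounded f x | x in `[a, b]] ->
   completed_lebesgue_measure.-integrable `[a, b] (EFin \o f) ->
   forall x, x \in `[a, b] -> f @ within `[a, b] (nbhs x) --> f x ->
     steklov_op sigma a b r n f x @[n --> \oo] --> f x) /\
  ({within `[a, b], continuous f} ->
   sup_norm a b (fun x => steklov_op sigma a b r n f x - f x) @[n --> \oo]
     --> 0%E).
Proof.
have phi_gt0 : 0 < phi sigma (r%:R + 1).
  rewrite /phi mulr_gt0 ?invr_gt0// subr_gt0 addrK.
  by have -> : r%:R + 1 + 1 = r%:R + 2 :> R by ring.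
have op_dist M e delta := @steklov_op_dist_near R sigma sigma_nondecreasing
  sigma_sigmoidal sigma_odd sigma_concave a b r phi_gt0 M e delta hr hab.
have half e : 0 < e -> exists2 e', 0 < e' & 2 ^+ r * (e' + e') = e :> R.
  move=> e0; exists (e / 2 / 2 ^+ r); first by rewrite !divr_gt0 ?exprn_gt0.
  by field; rewrite gt_eqF// exprn_gt0.
split=> [bf _ x xab fx|fc].
  have [M M0 hM] := ex_strict_bound_gt0 bf.
  apply/cvgrPdist_le => e /half[e' e'0 <-].
  move/cvgrPdist_le : fx => /(_ _ e'0).
  rewrite /prop_near1 /within/= => /nbhs_ballP[d /= d0 hd].
  have d20 : 0 < d / 2 by lra.
  near=> n; rewrite distrC.
  have H : forall (f : R -> R) (x : R), a <= x <= b ->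
    (forall y, a <= y <= b -> `|f y| <= M) ->
    (forall y, a <= y <= b -> `|y - x| <= d / 2 -> `|f y - f x| <= e') ->
    `|steklov_op sigma a b r n f x - f x| <= 2 ^+ r * (e' + e').
    by near: n; exact: (op_dist M e' (d / 2) (ltW M0) e'0 d20).
  apply: H => [|y ayb|y ayb yx]; first by rewrite in_itv in xab.
    by apply/ltW/hM; rewrite /= in_itv.
  rewrite distrC; apply: hd; last by rewrite /= in_itv.
  by rewrite /ball/= distrC; lra.
have bf : bounded_set [set f x | x in `[a, b]].
  exact/compact_bounded/(continuous_compact fc)/segment_compact.
have [M M0 hM] := ex_strict_bound_gt0 bf.
have fM y : a <= y <= b -> `|f y| <= M.
  by move=> ayb; apply/ltW/hM; exists y => //=; rewrite in_itv.
pose err n := sup_norm a b (fun x => steklov_op sigma a b r n f x - f x).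
have err0 n : (0 <= err n)%E.
  apply: le_ereal_sup_tmp; exists (`|steklov_op sigma a b r n f a - f a|)%:E.
    by exists a => //=; rewrite in_itv/= lexx ltW//.
  by rewrite lee_fin.
have erre e : 0 < e -> \forall n \near \oo, (err n <= e%:E)%E.
  move=> /half[e' e'0 <-].
  have [d d0 hd] := segment_unif_continuous fc e'0.
  have := op_dist M e' d (ltW M0) e'0 d0.
  apply: filterS => n H; apply: ge_ereal_sup => _ [x /= xab <-].
  rewrite in_itv/= in xab; rewrite lee_fin; apply: H => // y ayb; exact: hd.
apply/fine_cvgP; split.
  have := erre 1 ltr01; apply: filterS => n n1.
  by rewrite (ge0_fin_numE (err0 n)); apply: le_lt_trans n1 _; rewrite ltry.
apply/cvgrPdist_le => e e0; have := erre e e0; apply: filterS => n ne.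
have errn : err n \is a fin_num.
  by rewrite (ge0_fin_numE (err0 n)); apply: le_lt_trans ne _; rewrite ltry.
rewrite sub0r normrN ger0_norm; first by rewrite -lee_fin fineK.
by apply: fine_ge0; exact: err0.
Unshelve. all: by end_near. Qed.
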